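(* Let $L$ be an integral domain, let $K\subset L$ be an infinite subring, and let $\mathrm{Num}_{L/K}$, $\Gamma_L$, $\mathrm{ev}_{L/K}$ and $\mathrm{ev}^*_{L/K}$ be as defined in the context. Consider the following conditions. (1) $L$ is a DS-extension of the ring $K$. (2) The map $\mathrm{ev}_{L/K}:L[x]\to\mathrm{Map}(K,L)$ is asymptotically split (equivalently, the map $\mathrm{ev}^*_{L/K}:L[K]\to\Gamma_L$ has a dense image). (3) There exist no nontrivial numerical polynomials, i.e. $\mathrm{Num}_{L/K}=L[x]$. (4) For any noninvertible element $a\in L$ the composite map $K\hookrightarrow L\to L/(a)$ has an infinite image. Then $(1)\Rightarrow(2)\Rightarrow(3)\Rightarrow(4)$. If $L$ is a unique factorization domain, then (4) implies (3). If, further, $L$ is a discrete valuation ring, then (4) implies (1).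
   Context: DS-extension: let $Q$ be a subring of a commutative ring $R$ with no zero divisors. $R$ is a DS-extension of $Q$ if there exists an infinite sequence of elements $q_i\in Q$, $i=1,2,\ldots$, such that all differences $q_i-q_j$ with $i\ne j$ are invertible in $R$. $\hat L$ is the field of fractions of $L$. The ring of $L/K$-numerical polynomials $\mathrm{Num}_{L/K}$ is the ring of polynomials $P\in\hat L[x]$ such that $P(k)\in L$ for all $k\in K$ (that is, the pullback of the evaluation map $\hat L[x]\to\mathrm{Map}(K,\hat L)$ along $\mathrm{Map}(K,L)\to\mathrm{Map}(K,\hat L)$). $L[K]$ denotes the free $L$-module on the set $K$, with basis vectors $[k]$, $k\in K$. $\mathrm{Map}(K,L)$ is the $L$-module of all functions $K\to L$, with the $L$-linear topology in which a fundamental system of neighborhoods of $0$ is given by the submodules $\{g: g(k)=0 \text{ for all } k\in X\}$, with $X$ running over finite subsets of $K$. The evaluation map $\mathrm{ev}_{L/K}:L[x]\to\mathrm{Map}(K,L)$ sends a polynomial $p$ to the function $k\mapsto p(k)$. $\Gamma_L:=\mathrm{Hom}_L(L[x],L)\cong\mathrm{Hom}_K(K[x],L)$, with the linear topology in which a fundamental system of neighborhoods of $0$ is given by the annihilators $\{l: l(v)=0\text{ for all }v\in U\}$ of free finite rank $L$-submodules $U\subset L[x]$. The dual evaluation map $\mathrm{ev}^*_{L/K}:L[K]\to\Gamma_L$ is the $L$-linear map with $\mathrm{ev}^*_{L/K}([k])(p)=p(k)$. For a free $L$-module $V$, a submodule $U\subset V$ is admissible if $U$ is free of finite rank and is a direct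 summand of $V$ as an $L$-module. For $V$ a free $L$-module and $W$ an $L$-module with an $L$-linear topology, an $L$-module homomorphism $\phi:V\to W$ is asymptotically split if for every admissible $U\subset V$ the composition $U\hookrightarrow V\to W$ has a continuous left inverse $L$-module homomorphism $W\to U$ ($U$ being discrete). *)

(* Defs.v *)
From HB Require Import structures.
From mathcomp Require Import all_boot all_order all_algebra.
From mathcomp Require Import finmap monalg.
From mathcomp Require Import boolp classical_sets functions cardinality.
From mathcomp Require Import topology.

Set Implicit Arguments.
Unset Strict Implicit.
Unset Printing Implicit Defensive.

Import GRing.Theory.

Local Open Scope classical_set_scope.
Local Open Scope ring_scope.

(* Linear topologies on modules: translation-invariant topologies with a basis
   of neighbourhoods of 0 made of open submodules. *)

HB.mixin Record Topological_isLinear (R : nzRingType) W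
    of Topological W & GRing.Lmodule R W := {
  open_translate : forall (x : W) (A : set W), open A -> open (+%R x @` A) ;
  nbhs0_submod : forall A : set W, nbhs (0 : W) A ->
    exists2 N : submodClosed W, open [set` N] & [set` N] `<=` A
}.

#[short(type="linTopologicalType")]
HB.structure Definition LinTopological (R : nzRingType) :=
  {W of Topological W & GRing.Lmodule R W & Topological_isLinear R W}.

(* The linear topology having a given filtered family of submodules as a
   fundamental system of neighbourhoods of 0. *)
HB.factory Record Lmodule_isLinTopological (R : nzRingType) W
    of GRing.Lmodule R W := {
  base0 : set (submodClosed W) ;
  base0_neq0 : base0 !=set0 ;
  base0I : forall M N, base0 M -> base0 N ->
    exists2 P, base0 P & [set` P] `<=` [set` M] `&` [set` N]
}.

HB.builders Context (R : nzRingType) W of Lmodule_isLinTopological R W.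

Definition lin_open : set_system W := [set A | forall x, A x ->
  exists2 N, base0 N & +%R x @` [set` N] `<=` A].

Let lin_openT : lin_open setT.
Proof. by move=> x _; have [N BN] := base0_neq0; exists N. Qed.

Let lin_openI : setI_closed lin_open.
Proof.
move=> A B oA oB x [/oA[M BM MA] /oB[N BN NB]].
have [P BP PMN] := base0I BM BN; exists P => // _ [y /PMN[yM yN] <-].
by split; [apply: MA|apply: NB]; exists y.
Qed.

Let lin_open_bigU (I : Type) (f : I -> set W) :
  (forall i, lin_open (f i)) -> lin_open (\bigcup_i f i).
Proof.
move=> of_ x [i _ /of_[N BN Nf]]; exists N => // y /Nf fy; by exists i.
Qed.

HB.instance Definition _ :=
  isOpenTopological.Build W lin_openT lin_openI lin_open_bigU.

Let lin_open_translate (x : W) (A : set W) : open A -> open (+%R x @` A).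
Proof.
change (lin_open A -> lin_open (+%R x @` A)).
move=> oA _ [a /oA[N BN NA] <-]; exists N => // _ [y yN <-].
by exists (a + y); [apply: NA; exists y|rewrite addrA].
Qed.

Let lin_nbhs0 (A : set W) : nbhs (0 : W) A ->
  exists2 N : submodClosed W, open [set` N] & [set` N] `<=` A.
Proof.
rewrite nbhsE => -[B [oB B0] BA].
have [N BN NB] : exists2 N, base0 N & +%R 0 @` [set` N] `<=` B by exact: oB.
exists N; last by move=> x xN; apply/BA/NB; exists x; rewrite ?add0r.
change (lin_open [set` N]) => x xN.
by exists N => // _ [y yN <-]; apply: rpredD.
Qed.

HB.instance Definition _ :=
  Topological_isLinear.Build R W lin_open_translate lin_nbhs0.

HB.end.

Section Submodules.
Variables (R : nzRingType) (V : lmodType R).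

Record submodule (U : submodClosed V) :=
  Submodule { submodule_val :> V ; _ : submodule_val \in U }.

HB.instance Definition _ (U : submodClosed V) :=
  [isSub for @submodule_val U].
HB.instance Definition _ (U : submodClosed V) :=
  [Choice of submodule U by <:].
HB.instance Definition _ (U : submodClosed V) :=
  [SubChoice_isSubLmodule of submodule U by <:].

Definition direct_summand (U : submodClosed V) : Prop :=
  exists U' : submodClosed V,
    (forall v, exists u u', [/\ u \in U, u' \in U' & v = u + u']) /\
    (forall v, v \in U -> v \in U' -> v = 0).

End Submodules.

Definition free_of_finite_rank (R : nzRingType) (M : lmodType R) : Prop :=
  exists n (f : {linear 'rV[R]_n -> M}), bijective f.

Definition admissible (R : nzRingType) (V : lmodType R) (U : submodClosed V) :=
  free_of_finite_rank (submodule U) /\ direct_summand U.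

(* The notion is only used for free V; its definition does not need freeness. *)
Definition asymptotically_split (R : nzRingType) (V : lmodType R)
    (W : linTopologicalType R) (phi : {linear V -> W}) : Prop :=
  forall U : submodClosed V, admissible U ->
  exists2 r : {linear W -> submodule U},
    continuous (r : W -> discrete_topology (submodule U)) &
    forall u : submodule U, r (phi (val u)) = u.

Definition DS_extension (R : idomainType) (Q : subringClosed R) : Prop :=
  exists q : nat -> R, (forall i, q i \in Q) /\
    (forall i j, i != j -> q i - q j \is a GRing.unit).

Section NumericalPolynomials.
Variables (L : idomainType) (K : subringClosed L).

Definition NumPoly : {pred {poly {fraction L}}} := [pred P |
  `[< forall k, k \in K -> exists l : L, P.[tofrac k] = tofrac l >]].

Fact NumPoly_subring_closed : subring_closed NumPoly.
Proof.
split=> [|P Q /asboolP hP /asboolP hQ|P Q /asboolP hP /asboolP hQ];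
  apply/asboolP => k kK.
- by exists 1; rewrite hornerC rmorph1.
- have [[a Pa] [b Qb]] := (hP k kK, hQ k kK).
  by exists (a - b); rewrite hornerD hornerN Pa Qb rmorphB.
- have [[a Pa] [b Qb]] := (hP k kK, hQ k kK).
  by exists (a * b); rewrite hornerM Pa Qb rmorphM.
Qed.
HB.instance Definition _ :=
  GRing.isSubringClosed.Build _ NumPoly NumPoly_subring_closed.

End NumericalPolynomials.

Section PrincipalIdeals.
Variables (L : comNzRingType) (a : L).

Definition principal_ideal : {pred L} := [pred x | `[< exists c, x = c * a >]].

Fact principal_ideal_zmod_closed : zmod_closed principal_ideal.
Proof.
split=> [|_ _ /asboolP[b ->] /asboolP[c ->]]; apply/asboolP.
  by exists 0; rewrite mul0r.
by exists (b - c); rewrite mulrBl.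
Qed.
HB.instance Definition _ :=
  GRing.isZmodClosed.Build L principal_ideal principal_ideal_zmod_closed.

End PrincipalIdeals.

Section Evaluation.
Variables (L : idomainType) (K : subringClosed L).

Definition elt : Type := {k : L | k \in K}.
HB.instance Definition _ := Choice.on elt.

Definition Map : Type := elt -> L^o.
HB.instance Definition _ := GRing.Lmodule.on Map.

Definition vanishing (X : set elt) : {pred Map} :=
  [pred g | `[< forall k, X k -> g k = 0 >]].

Fact vanishing_submod_closed X : submod_closed (vanishing X).
Proof.
split=> [|a f g /asboolP f0 /asboolP g0]; apply/asboolP => k Xk //.
change (a *: f k + g k = 0).
by rewrite f0 // g0 // addr0 scaler0.
Qed.
HB.instance Definition _ X :=
  GRing.isSubmodClosed.Build L Map (vanishing X) (vanishing_submod_closed X).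

Let Map_base : set (submodClosed Map) :=
  [set (vanishing X : submodClosed Map) | X in @finite_set elt].

Let Map_base_neq0 : Map_base !=set0.
Proof. by exists (vanishing set0 : submodClosed Map); exists set0. Qed.

Let Map_baseI M N : Map_base M -> Map_base N ->
  exists2 P, Map_base P & [set` P] `<=` [set` M] `&` [set` N].
Proof.
move=> [X finX <-] [Y finY <-].
exists (vanishing (X `|` Y) : submodClosed Map).
  by exists (X `|` Y) => //; rewrite /= finite_setU.
move=> g /= /asboolP gXY; split; apply/asboolP => k kXY; apply: gXY;
  by [left|right].
Qed.

HB.instance Definition _ :=
  Lmodule_isLinTopological.Build L Map Map_base_neq0 Map_baseI.

Lemma nbhs0_MapE (A : set Map) : nbhs (0 : Map) A <->
  exists2 X : set elt, finite_set X & [set` vanishing X] `<=` A.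
Proof.
rewrite nbhsE; split=> [[B [oB B0] BA]|[X finX XA]].
  have [_ [X finX <-] XB] : exists2 N, Map_base N & +%R 0 @` [set` N] `<=` B.
    exact: oB.
  by exists X => // g gX; apply/BA/XB; exists g; rewrite ?add0r.
exists [set` vanishing X] => //; split; last exact: rpred0.
move=> f fX; exists (vanishing X : submodClosed Map); first by exists X.
by move=> _ [g gX <-]; apply: rpredD.
Qed.

Definition ev (p : {poly L}) : Map := fun k => p.[val k].

Fact ev_linear : linear ev.
Proof.
by move=> a p q; apply/funext => k; rewrite /ev hornerD hornerZ.
Qed.
HB.instance Definition _ :=
  GRing.isLinear.Build L {poly L} Map _ ev ev_linear.

End Evaluation.

Section Gamma.
Variable L : idomainType.

Definition Gamma : Type := {linear {poly L} -> L^o}.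

Definition Gamma_fun (l : Gamma) : {linear {poly L} -> L^o} := l.
Coercion Gamma_fun : Gamma >-> GRing.Linear.type.

HB.instance Definition _ := gen_eqMixin Gamma.
HB.instance Definition _ := gen_choiceMixin Gamma.

Implicit Types l m : Gamma.

Lemma GammaP l m : (forall p, l p = m p) -> l = m.
Proof.
case: l m => [f [[fD] [fZ]]] [g [[gD] [gZ]]] /funext /= fg.
move: fD fZ gD gZ; rewrite {}fg => fD fZ gD gZ.
by rewrite (Prop_irrelevance fD gD) (Prop_irrelevance fZ gZ).
Qed.

Definition Gamma0 : Gamma := GRing.Linear.clone _ _ _ _ \0 _.
Definition Gamma_opp l : Gamma := GRing.Linear.clone _ _ _ _ (\- l) _.
Definition Gamma_add l m : Gamma := GRing.Linear.clone _ _ _ _ (l \+ m) _.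
Definition Gamma_scale a l : Gamma := GRing.Linear.clone _ _ _ _ (a \*: l) _.

Fact Gamma_addA : associative Gamma_add.
Proof. by move=> l m n; apply: GammaP => p; apply: addrA. Qed.
Fact Gamma_addC : commutative Gamma_add.
Proof. by move=> l m; apply: GammaP => p; apply: addrC. Qed.
Fact Gamma_add0 : left_id Gamma0 Gamma_add.
Proof. by move=> l; apply: GammaP => p; apply: add0r. Qed.
Fact Gamma_addN : left_inverse Gamma0 Gamma_opp Gamma_add.
Proof. by move=> l; apply: GammaP => p; apply: addNr. Qed.
HB.instance Definition _ := GRing.isZmodule.Build Gamma
  Gamma_addA Gamma_addC Gamma_add0 Gamma_addN.

Fact Gamma_scaleA a b l :
  Gamma_scale a (Gamma_scale b l) = Gamma_scale (a * b) l.
Proof. by apply: GammaP => p; apply: scalerA. Qed.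
Fact Gamma_scale1 : left_id 1 Gamma_scale.
Proof. by move=> l; apply: GammaP => p; apply: scale1r. Qed.
Fact Gamma_scaleDr : right_distributive Gamma_scale +%R.
Proof. by move=> a l m; apply: GammaP => p; apply: scalerDr. Qed.
Fact Gamma_scaleDl l : {morph Gamma_scale^~ l : a b / a + b}.
Proof. by move=> a b; apply: GammaP => p; apply: scalerDl. Qed.
HB.instance Definition _ := GRing.Zmodule_isLmodule.Build L Gamma
  Gamma_scaleA Gamma_scale1 Gamma_scaleDr Gamma_scaleDl.

Definition annihilator (U : submodClosed {poly L}) : {pred Gamma} :=
  [pred l : Gamma | `[< forall v, v \in U -> l v = 0 >]].

Fact annihilator_submod_closed U : submod_closed (annihilator U).
Proof.
split=> [|a l m /asboolP l0 /asboolP m0]; apply/asboolP => v vU //.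
change (a *: l v + m v = 0).
by rewrite l0 // m0 // addr0 scaler0.
Qed.
HB.instance Definition _ U := GRing.isSubmodClosed.Build L Gamma
  (annihilator U) (annihilator_submod_closed U).

Let Gamma_base : set (submodClosed Gamma) :=
  [set (annihilator U : submodClosed Gamma) |
    U in [set U | free_of_finite_rank (submodule U)]].

Definition poly_lt n : {pred {poly L}} := [pred p : {poly L} | (size p <= n)%N].

Fact poly_lt_submod_closed n : submod_closed (poly_lt n).
Proof.
split=> [|a p q]; rewrite !inE ?size_poly0 // => sp sq.
by rewrite (leq_trans (size_polyD _ _)) // geq_max sq
  (leq_trans (size_scale_leq _ _)).
Qed.
HB.instance Definition _ n := GRing.isSubmodClosed.Build L {poly L}
  (poly_lt n) (poly_lt_submod_closed n).

Lemma poly_lt_free n : free_of_finite_rank (submodule (poly_lt n)).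
Proof.
have ltn_rV (v : 'rV[L]_n) : rVpoly v \in poly_lt n by apply: size_poly.
pose f v : submodule (poly_lt n) := Submodule (ltn_rV v).
have f_lin : linear f by move=> a u v; apply: val_inj; rewrite /= linearP.
pose fL : {linear 'rV[L]_n -> submodule (poly_lt n)} := HB.pack f
  (GRing.isLinear.Build _ _ _ _ f f_lin).
exists n, fL.
exists (fun p : submodule (poly_lt n) => poly_rV (val p)) => [v|[p pn]].
  exact: rVpolyK.
by apply: val_inj; apply: poly_rV_K.
Qed.

Lemma free_poly_lt (U : submodClosed {poly L}) :
  free_of_finite_rank (submodule U) -> exists n, {subset U <= poly_lt n}.
Proof.
move=> [n [f [g _ gK]]].
exists (\max_i size (val (f (delta_mx 0%R i)))) => p pU; rewrite inE.
rewrite -[p]/(val (Submodule pU)) -(gK (Submodule pU)).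
rewrite (row_sum_delta (g _)) linear_sum raddf_sum.
apply: (leq_trans (size_sum _ _ _)); apply/bigmax_leqP => i _.
rewrite !linearZ (leq_trans (size_scale_leq _ _)) //.
exact: leq_bigmax.
Qed.

Let Gamma_base_neq0 : Gamma_base !=set0.
Proof.
exists (annihilator (poly_lt 0) : submodClosed Gamma).
by exists (poly_lt 0 : submodClosed {poly L}) => //; apply: poly_lt_free.
Qed.

Let Gamma_baseI M N : Gamma_base M -> Gamma_base N ->
  exists2 P, Gamma_base P & [set` P] `<=` [set` M] `&` [set` N].
Proof.
move=> [U /free_poly_lt[m Um] <-] [V /free_poly_lt[n Vn] <-].
exists (annihilator (poly_lt (maxn m n)) : submodClosed Gamma).
  by exists (poly_lt (maxn m n) : submodClosed {poly L}) => //;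
    apply: poly_lt_free.
move=> l /= /asboolP l0.
split; apply/asboolP => v.
  by move/Um => vm; apply: l0; rewrite !inE in vm *; rewrite leq_max vm.
by move/Vn => vn; apply: l0; rewrite !inE in vn *; rewrite leq_max vn orbT.
Qed.

HB.instance Definition _ :=
  Lmodule_isLinTopological.Build L Gamma Gamma_base_neq0 Gamma_baseI.

Lemma nbhs0_GammaE (A : set Gamma) : nbhs (0 : Gamma) A <->
  exists2 U : submodClosed {poly L},
    free_of_finite_rank (submodule U) & [set` annihilator U] `<=` A.
Proof.
rewrite nbhsE; split=> [[B [oB B0] BA]|[U freeU UA]].
  have [_ [U freeU <-] UB] : exists2 N, Gamma_base N & +%R 0 @` [set` N] `<=` B.
    exact: oB.
  by exists U => // l lU; apply/BA/UB; exists l; rewrite ?add0r.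
exists [set` annihilator U] => //; split; last exact: rpred0.
move=> l lU; exists (annihilator U : submodClosed Gamma); first by exists U.
by move=> _ [m mU <-]; apply: rpredD.
Qed.

End Gamma.

Section DualEvaluation.
Variables (L : idomainType) (K : subringClosed L).
Implicit Type c : {malg L[elt K]}.

Definition dual_ev_fun c (p : {poly L}) : L^o :=
  \sum_(k <- msupp c) c@_k * p.[val k].

Fact dual_ev_fun_linear c : linear (dual_ev_fun c).
Proof.
move=> a p q; rewrite /dual_ev_fun scaler_sumr -big_split /=.
apply: eq_bigr => k _; rewrite hornerD hornerZ mulrDr.
by congr (_ + _); rewrite mulrCA.
Qed.
HB.instance Definition _ c := GRing.isLinear.Build L {poly L} L^o _
  (dual_ev_fun c) (dual_ev_fun_linear c).

Definition dual_ev c : Gamma L := dual_ev_fun c : {linear _ -> _}.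

Fact dual_ev_linear : linear dual_ev.
Proof.
have wide c (X : {fset elt K}) p : (msupp c `<=` X)%fset ->
    dual_ev c p = \sum_(k <- X) c@_k * p.[val k].
  move=> cX; rewrite /dual_ev /= /dual_ev_fun (big_fset_incl _ cX) //= => k _.
  by move=> /mcoeff_outdom ->; rewrite mul0r.
move=> a c d; apply: GammaP => p.
pose X := (msupp (a *: c + d) `|` (msupp c `|` msupp d))%fset.
change (dual_ev (a *: c + d) p = a *: dual_ev c p + dual_ev d p).
rewrite !(wide _ X) ?fsubsetUl //; first last.
- by rewrite fsubsetU // fsubsetUl orbT.
- by rewrite fsubsetU // fsubsetUr orbT.
rewrite scaler_sumr -big_split /=; apply: eq_bigr => k _.
by rewrite mcoeffD mcoeffZ mulrDl; congr (_ + _); rewrite -mulrA.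
Qed.
HB.instance Definition _ := GRing.isLinear.Build L {malg L[elt K]} (Gamma L) _
  dual_ev dual_ev_linear.

Lemma dual_evU (k : elt K) p : dual_ev << k >> p = p.[val k].
Proof.
rewrite /dual_ev /= /dual_ev_fun msuppU oner_eq0 big_seq_fset1.
by rewrite mcoeffUU mul1r.
Qed.

End DualEvaluation.

Section Factoriality.
Variable L : idomainType.
Implicit Types (x y : L) (s t : seq L).

Definition irreducible_elt x : Prop :=
  [/\ x != 0, x \isn't a GRing.unit & forall y z, x = y * z ->
    y \is a GRing.unit \/ z \is a GRing.unit].

Definition associates x y : bool :=
  `[< exists2 u, u \is a GRing.unit & y = u * x >].

Definition is_UFD : Prop :=
  (forall x, x != 0 -> x \isn't a GRing.unit ->
    exists2 s, (forall y, y \in s -> irreducible_elt y) & x = \prod_(y <- s) y) /\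
  (forall s t, (forall y, y \in s -> irreducible_elt y) ->
    (forall y, y \in t -> irreducible_elt y) ->
    associates (\prod_(y <- s) y) (\prod_(y <- t) y) ->
    exists2 t', perm_eq t t' & all2 associates s t').

(* L is the valuation ring of a discrete valuation of its field of fractions;
   the value of v at 0 (morally +oo) is irrelevant. *)
Definition is_DVR : Prop := exists v : {fraction L} -> int,
  [/\ forall f g, f != 0 -> g != 0 -> v (f * g) = v f + v g,
      forall f g, f != 0 -> g != 0 -> f + g != 0 ->
        Order.min (v f) (v g) <= v (f + g),
      forall n, exists2 f, f != 0 & v f = n &
      forall f, f != 0 -> (0 <= v f <-> exists x, f = tofrac x)].

End Factoriality.

(* Main.v *)
From HB Require Import structures.
Require Import Defs.
From mathcomp Require Import all_boot all_order all_algebra generic_quotient.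
From mathcomp Require Import finmap monalg.
From mathcomp Require Import boolp classical_sets functions cardinality.
From mathcomp Require Import topology.

Import GRing.Theory.

Local Open Scope classical_set_scope.
Local Open Scope ring_scope.

(** The conditions meet in one elementary property, [extracts_coefficients]:
    in each degree bound, every coefficient of a polynomial over L is a fixed
    finite L-linear combination of its values at points of K.  Both
    topological forms of (2) say exactly this.  A continuous left inverse of
    the evaluation on polynomials of bounded degree depends on finitely many
    values only, so its coordinates are such combinations; conversely such
    combinations rebuild a polynomial of bounded degree from its values, and an
    admissible submodule is a direct summand contained in such a bounded part
    ([split_extracts], [extracts_split]).  Likewise a neighbourhood in Gamma
    only sees polynomials of bounded degree, so density of the image of L[K]
    means that on each bounded part every functional, in particular each
    coefficient, agrees with a combination of evaluations ([dense_extracts],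
    [extracts_dense]).

    The link between values and coefficients is the Vandermonde matrix: its
    adjugate expresses the determinant times any coefficient through the
    values ([adjugate_interpolation]).  If all differences of the nodes are
    units, the determinant is invertible and (1) gives the required combinations
    ([DS_extracts]).  Such formulas over L persist over the field of
    fractions, so they express the coefficients of a numerical polynomial
    through its values, which lie in L: this is (3) ([extracts_numerical]).
    If some nonzero nonunit a had only finitely many residues k_1, ..., k_m of
    elements of K, then the product of the X - k_i divided by a would be
    numerical but not integral, hence (3) implies (4)
    ([no_numerical_infinite_residues]).

    For factorial L, a prime p and infinitely many residues of K modulo p, the
    same adjugate identity shows that if p divides all values of Q on K then p
    divides all coefficients of Q, since the determinant is prime to p
    ([prime_divides_coefs]).  The denominator of a numerical polynomial can
    therefore be removed one prime factor at a time ([UFD_numerical]).  In a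
    discrete valuation ring, elements that are incongruent modulo a uniformizer
    differ by a unit, so representatives of infinitely many residues form the
    sequence required by (1) ([DVR_DS]). *)

(** * Interpolation through the adjugate of a Vandermonde matrix *)

(** The values of p at the nodes are the row of its coefficients times the
    Vandermonde matrix V, and V * adj V = det V.  Leaving the determinant
    undivided keeps the identity usable when the differences of the nodes are
    merely prime to something instead of invertible. *)
Lemma adjugate_interpolation {R : comNzRingType} (q : nat -> R) (n i : nat) :
  exists w : 'I_n -> R, forall p : {poly R}, (size p <= n)%N ->
    \sum_(m < n) w m * p.[q m] =
    (\prod_(j < n) \prod_(m < n | (j < m)%N) (q m - q j)) * p`_i.
Proof.
have [lt_in | le_ni] := ltnP i n; last first.
  (* the coefficient vanishes: its index is beyond the degree bound *)
  exists (fun=> 0) => p sp; rewrite big1 ?nth_default ?mulr0 //.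
    exact: leq_trans sp le_ni.
  by move=> m _; rewrite mul0r.
pose a : 'rV[R]_n := \row_m q m; pose V := Vandermonde n a.
exists (fun m => (\adj V) m (Ordinal lt_in)) => p sp.
have detV : \det V = \prod_(j < n) \prod_(m < n | (j < m)%N) (q m - q j).
  rewrite det_Vandermonde; apply: eq_bigr => j _; apply: eq_bigr => m _.
  by rewrite !mxE.
have evV m : (poly_rV p *m V) 0 m = p.[q m].
  rewrite mxE (horner_coef_wide _ sp); apply: eq_bigr => j _.
  by rewrite !mxE.
have: (poly_rV p *m V *m \adj V) 0 (Ordinal lt_in) =
      \det V * poly_rV p 0 (Ordinal lt_in).
  by rewrite -mulmxA mul_mx_adj mul_mx_scalar mxE.
rewrite detV [poly_rV _ _ _]mxE => <-; rewrite mxE; apply: eq_bigr => m _.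
by rewrite evV mulrC.
Qed.

(** * Extracting coefficients from values *)

Section CoefficientsFromValues.
Context {L : idomainType} (K : subringClosed L).

(** No bound is put on [i]: for [n <= i] the combination [0] does. *)
Definition extracts_coefficients : Prop :=
  forall n i : nat, exists c : {malg L[elt K]},
    forall p : {poly L}, (size p <= n)%N -> dual_ev c p = p`_i.

Lemma dual_ev_lincomb {I : Type} (s : seq I) (w : I -> L)
    (c : I -> {malg L[elt K]}) p :
  dual_ev (\sum_(m <- s) w m *: c m) p = \sum_(m <- s) w m * dual_ev (c m) p.
Proof.
rewrite linear_sum /=.
have -> : \sum_(m <- s) w m * dual_ev (c m) p =
          \sum_(m <- s) (dual_ev (w m *: c m)) p.
  by apply: eq_bigr => m _; rewrite linearZ.
exact: (big_morph (fun l : Gamma L => l p)).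
Qed.

(** All factors of the Vandermonde determinant are units, so the adjugate
    identity can be divided by it. *)
Lemma DS_extracts : DS_extension K -> extracts_coefficients.
Proof.
move=> [q [qK q_unit]] n i.
have [w wP] := adjugate_interpolation q n i.
set D := \prod_(j < n) _ in wP.
have uD : D \is a GRing.unit.
  apply: rpred_prod => j _; apply: rpred_prod => m lt_jm.
  by apply: q_unit; rewrite gtn_eqF.
exists (\sum_(m < n) (D^-1 * w m) *: << (exist _ (q m) (qK m) : elt K) >>).
move=> p sp; rewrite dual_ev_lincomb.
under eq_bigr => m _ do rewrite dual_evU -mulrA.
by rewrite -mulr_sumr wP // mulKr.
Qed.

(** A functional is determined on polynomials of bounded degree by its values
    on monomials, so extracting the coefficients suffices to extract it. *)
Lemma extracts_functional {n : nat} (l : Gamma L) :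
  extracts_coefficients ->
  exists c : {malg L[elt K]},
    forall p : {poly L}, (size p <= n)%N -> dual_ev c p = l p.
Proof.
move=> /(_ n) /choice[c cP].
exists (\sum_(i < n) l 'X^i *: c i) => p sp.
rewrite dual_ev_lincomb.
rewrite -{2}[p]coefK (poly_def (size p)) linear_sum /=.
rewrite (big_ord_widen _ (fun i => l (p`_i *: 'X^i)) sp) [RHS]big_mkcond /=.
apply: eq_bigr => i _; rewrite cP // linearZ /= mulrC.
by case: ltnP => // /(nth_default 0) ->; rewrite mul0r.
Qed.

End CoefficientsFromValues.

(** * Linear topologies, direct summands and discrete targets *)

(** Choice provides a decomposition of each vector; the trivial intersection
    makes the component unique, hence linear in the vector. *)
Lemma direct_summand_projection (R : nzRingType) (V : lmodType R)
    (U : submodClosed V) : direct_summand U ->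
  exists pi : {linear V -> submodule U}, forall u, pi (val u) = u.
Proof.
move=> [U' [decomp disj]].
have /choice[f fP] v : exists u : submodule U, v - val u \in U'.
  have [u [u' [uU u'U' ->]]] := decomp v.
  by exists (Submodule uU); rewrite /= addrC addKr.
have f_uniq v u : v - val u \in U' -> f v = u.
  move=> vu; apply/eqP; rewrite -subr_eq0; apply/eqP/val_inj/disj.
    exact: valP.
  have -> : val (f v - u) = (v - val u) + (-1) *: (v - val (f v)).
    by rewrite raddfB scaleN1r opprB [RHS]addrC addrA subrK.
  by apply: rpredD => //; apply: rpredZ.
have f_lin : linear f.
  move=> a u v; apply: f_uniq.
  have -> : a *: u + v - val (a *: f u + f v) =
            a *: (u - val (f u)) + (v - val (f v)).
    change (val (a *: f u + f v)) with (a *: val (f u) + val (f v)).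
    by rewrite scalerBr opprD addrACA.
  by apply: rpredD => //; apply: rpredZ.
pose fL : {linear V -> submodule U} := HB.pack f
  (GRing.isLinear.Build _ _ _ _ f f_lin).
by exists fL => u; apply: f_uniq; rewrite subrr rpred0.
Qed.

(** Linearity and translations reduce continuity to the point 0. *)
Lemma linear_continuous_discrete (R : nzRingType) (W : linTopologicalType R)
    (V : lmodType R) (r : {linear W -> V}) (A : set W) :
  nbhs (0 : W) A -> (forall x, A x -> r x = 0) ->
  continuous (r : W -> discrete_topology V).
Proof.
move=> /nbhs0_submod[N oN NA] rA x B /principal_filterP Bx.
rewrite /= nbhsE; exists (+%R x @` [set` N]).
  split; first exact: open_translate.
  by exists 0; [exact: rpred0|rewrite addr0].
by move=> _ [y /NA/rA ry <-] /=; rewrite linearD ry addr0.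
Qed.

Lemma continuous_discrete_ker (R : nzRingType) (W : linTopologicalType R)
    (V : lmodType R) (r : {linear W -> V}) :
  continuous (r : W -> discrete_topology V) -> nbhs (0 : W) [set x | r x = 0].
Proof.
move=> /(_ 0 [set 0]); apply; apply/principal_filterP => /=.
exact: linear0.
Qed.

(** * Density of the dual evaluation *)

Section Density.
Context {L : idomainType} {K : subringClosed L}.

(** A neighbourhood of l contains every functional that agrees with l on
    polynomials of some bounded degree. *)
Lemma extracts_dense : extracts_coefficients K -> dense (range (@dual_ev L K)).
Proof.
move=> ec O [l Ol] oO.
have [N oN NO] : exists2 N : submodClosed (Gamma L),
    open [set` N] & [set` N] `<=` +%R (- l) @` O.
  apply: nbhs0_submod; apply: open_nbhs_nbhs; split.
    exact: open_translate.
  by exists l => //; rewrite addNr.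
have /nbhs0_GammaE[U /free_poly_lt[n Un] UN] : nbhs (0 : Gamma L) [set` N].
  by apply: open_nbhs_nbhs; split => //; exact: rpred0.
have [c cP] := extracts_functional (n := n) K l ec.
exists (dual_ev c); split; last by exists c.
have /NO[m Om lm] : [set` N] (- l + dual_ev c).
  apply: UN; apply/asboolP => v /Un vn.
  change (- l v + dual_ev c v = 0).
  by rewrite cP ?addNr //; move: vn; rewrite inE.
by move/addrI: lm => <-.
Qed.

Definition coef_form (i : nat) : Gamma L :=
  (coefp i : {poly L} -> L^o) : {linear {poly L} -> L^o}.

(** Density is applied to the functionals that agree with the i-th coefficient
    on polynomials of size at most n. *)
Lemma dense_extracts : dense (range (@dual_ev L K)) ->
  extracts_coefficients K.
Proof.
move=> dns n i.
have [N oN NA] : exists2 N : submodClosed (Gamma L),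
    open [set` N] & [set` N] `<=` [set` annihilator (poly_lt n)].
  apply: nbhs0_submod; apply/nbhs0_GammaE.
  by exists (poly_lt n : submodClosed _) => //; exact: poly_lt_free.
have [|_ [[m Nm <-] [c _ cm]]] := dns _ _ (open_translate (coef_form i) _ oN).
  by exists (coef_form i + 0); exists 0 => //; exact: rpred0.
exists c => p sp; rewrite cm.
have /asboolP/(_ p) := NA _ Nm; rewrite inE => /(_ sp) mp.
change (p`_i + m p = p`_i).
by rewrite mp addr0.
Qed.

End Density.

(** * Asymptotic splitting of the evaluation *)

Section Splitting.
Context {L : idomainType} {K : subringClosed L}.

(** [dual_ev] extended from polynomials to arbitrary functions on K. *)
Definition pairing (c : {malg L[elt K]}) (g : Map K) : L :=
  \sum_(k <- msupp c) c@_k * g k.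

Fact pairing_linear c : linear_for *%R (pairing c).
Proof.
move=> a f g; rewrite /pairing mulr_sumr -big_split /=; apply: eq_bigr => k _.
change (c@_k * (a * f k + g k) = a * (c@_k * f k) + c@_k * g k).
by rewrite mulrDr mulrCA.
Qed.
HB.instance Definition _ c := GRing.isLinear.Build L (Map K) L *%R
  (pairing c) (pairing_linear c).

Lemma pairing_nbhs0 c : nbhs (0 : Map K) [set g | pairing c g = 0].
Proof.
apply/nbhs0_MapE; exists [set` msupp c].
  by apply: finite_fset.
move=> g /asboolP g0; rewrite /= /pairing big_seq big1 // => k kc.
by rewrite g0 ?mulr0.
Qed.

(** The complement consists of the multiples of [X^n]. *)
Lemma poly_lt_summand n : direct_summand (poly_lt n : submodClosed {poly L}).
Proof.
pose T : {pred {poly L}} := [pred p : {poly L} | take_poly n p == 0].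
have T_closed : submod_closed T.
  split=> [|a p q]; rewrite !inE ?take_poly0r // => /eqP p0 /eqP q0.
  by rewrite take_polyD take_polyZ p0 q0 scaler0 addr0.
pose U' : submodClosed {poly L} := HB.pack T
  (GRing.isSubmodClosed.Build L {poly L} T T_closed).
exists U'; split=> [v|v].
  exists (take_poly n v), (v - take_poly n v); split.
  - by rewrite inE size_take_poly.
  - rewrite inE -scaleN1r take_polyD take_polyZ scaleN1r.
    by rewrite (take_poly_id (size_take_poly _ _)) subrr.
  - by rewrite addrC subrK.
by rewrite !inE => sv /eqP <-; rewrite take_poly_id.
Qed.

(** The left inverse reads the coefficients off finitely many values and then
    projects onto U; it returns u in U because u has bounded degree. *)
Lemma extracts_split :
  extracts_coefficients K -> asymptotically_split (@ev L K).
Proof.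
move=> ec U [/free_poly_lt[n Un] /direct_summand_projection[pi piK]].
have [c cP] := choice (ec n).
pose r (g : Map K) : submodule U := pi (\sum_(i < n) pairing (c i) g *: 'X^i).
have r_lin : linear r.
  move=> a f g; rewrite /r -linearP scaler_sumr -big_split /=; congr (pi _).
  by apply: eq_bigr => i _; rewrite linearP scalerDl scalerA.
pose rL : {linear Map K -> submodule U} := HB.pack r
  (GRing.isLinear.Build _ _ _ _ r r_lin).
exists rL => [|u].
  apply: (@linear_continuous_discrete _ _ _ rL
    [set g | forall i : 'I_n, pairing (c i) g = 0]).
    exact: (@filter_forall (Map K) 'I_n (fun i g => pairing (c i) g = 0)
      (nbhs (0 : Map K)) _ (fun i => pairing_nbhs0 (c i))).
  move=> g g0; rewrite /= /r big1 ?linear0 // => i _.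
  by rewrite g0 scale0r.
rewrite /= /r; have /Un := valP u; rewrite inE => su.
rewrite -[RHS]piK; congr (pi _).
rewrite -[RHS](poly_rV_K su) /rVpoly poly_def; apply: eq_bigr => i _.
rewrite -[pairing _ _]/(dual_ev (c i) (val u)) cP //.
by case: insubP => [j _ /val_inj -> /=|/negP//]; rewrite mxE.
Qed.

(** A continuous left inverse r on polynomials of size at most n vanishes on
    functions vanishing on some finite set Y, so r (ev p) only depends on the
    values of p on Y: it is the combination of the images of the
    characteristic functions of the points of Y with these values. *)
Lemma split_extracts : asymptotically_split (@ev L K) ->
  extracts_coefficients K.
Proof.
move=> spl n i.
have [|r rc rK] := spl (poly_lt n : submodClosed _).
  by split; [exact: poly_lt_free|exact: poly_lt_summand].
have /nbhs0_MapE[X /finite_fsetP[Y XY] Xr] :=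
  continuous_discrete_ker _ _ _ _ rc.
pose delta (k : elt K) : Map K := fun x => (x == k)%:R.
exists (\sum_(k <- Y) (val (r (delta k)))`_i *: << k >>) => p sp.
rewrite dual_ev_lincomb.
have p_lt : p \in poly_lt n by rewrite inE.
have ev_p : r (ev p) = \sum_(k <- Y) p.[val k] *: r (delta k).
  apply/eqP; rewrite -subr_eq0; apply/eqP.
  under eq_bigr => k _ do rewrite -linearZ.
  rewrite -linear_sum -raddfB; apply: Xr; apply/asboolP => k.
  rewrite XY /= => kY.
  have -> : (ev p - \sum_(x <- Y) p.[val x] *: delta x) k =
            p.[val k] - \sum_(x <- Y) p.[val x] * (k == x)%:R.
    congr (_ - _).
    exact: (big_morph (fun g : Map K => g k) (id1 := 0) (op1 := +%R)).
  rewrite (big_fsetD1 k) //= eqxx mulr1 big1_fset ?addr0 ?subrr // => x.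
  by rewrite !inE => /andP[xk _] _; rewrite eq_sym (negPf xk) mulr0.
have -> : p`_i = (val (r (ev p)))`_i by rewrite (rK (Submodule p_lt)).
rewrite ev_p raddf_sum coef_sum; apply: eq_bigr => k _.
rewrite dual_evU.
change (val (p.[val k] *: r (delta k))) with (p.[val k] *: val (r (delta k))).
by rewrite coefZ mulrC.
Qed.

End Splitting.

(** * Denominators of polynomials over the field of fractions *)

Section Fractions.
Context {L : idomainType}.
Local Notation F := {fraction L}.

Lemma fraction_denominator (f : F) :
  exists a b : L, b != 0 /\ tofrac b * f = tofrac a.
Proof.
elim/quotW: f => x; exists (frac x).1, (frac x).2; split.
  exact: denom_ratioP.
rewrite !piE; apply/eqmodP; rewrite /= FracField.equivfE.
by rewrite /FracField.mulf !numden_Ratio ?mulf_neq0 ?oner_neq0 ?denom_ratioP //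
  mulr1 mul1r.
Qed.

Lemma poly_denominator (P : {poly F}) :
  exists (Q : {poly L}) (b : L),
    b != 0 /\ tofrac b *: P = map_poly (@tofrac L) Q.
Proof.
elim/poly_ind: P => [|P f [Q [b [b0 PQ]]]].
  by exists 0, 1; rewrite oner_neq0 scaler0 rmorph0.
have [a [d [d0 fa]]] := fraction_denominator f.
exists ((d *: Q) * 'X + (b * a)%:P), (b * d); rewrite mulf_neq0 //; split=> //.
rewrite rmorphD !rmorphM /= map_polyX map_polyC /= map_polyZ /= -PQ.
rewrite !map_polyC /= -fa scalerDr; congr (_ + _).
  by rewrite scalerA (mulrC (tofrac b)) scalerAl.
by rewrite -mul_polyC -!polyCM mulrA.
Qed.

Lemma fraction_poly_inj :
  injective (map_poly (@tofrac L) : {poly L} -> {poly F}).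
Proof.
apply: map_inj_poly (rmorph0 _) => x y /eqP.
by rewrite tofrac_eq => /eqP.
Qed.

End Fractions.

(** * Numerical polynomials and residues of K *)

Lemma principal_idealP {R : comNzRingType} {a x : R} :
  reflect (exists c, x = c * a) (x \in principal_ideal a).
Proof. exact: asboolP. Qed.

Section Residues.
Context {L : idomainType} {K : subringClosed L}.

Definition residues (a : L) :=
  [set (\pi_(Quotient.quot (principal_ideal a)) k)%qT | k in [set` K]].

Definition numerical_integral : Prop :=
  forall P, P \in NumPoly K -> exists p, P = map_poly (@tofrac L) p.

Lemma integral_is_numerical (p : {poly L}) :
  map_poly (@tofrac L) p \in NumPoly K.
Proof. by apply/asboolP => k _; exists p.[k]; rewrite horner_map. Qed.

(** The extraction formula, checked on monomials over L, holds for polynomials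
    over the field of fractions by linearity; for a numerical polynomial its
    right-hand side lies in L. *)
Lemma extracts_numerical : extracts_coefficients K -> numerical_integral.
Proof.
move=> ec P /asboolP Pnum.
suff /choice[a aP] : forall i, exists x, P`_i = tofrac x.
  exists (\poly_(i < size P) a i); apply/polyP => i.
  rewrite coef_map coef_poly /=; case: ltnP => // le_Pi.
  by rewrite nth_default ?rmorph0.
move=> i; have [c cP] := ec (size P) i.
have /choice[l lP] (k : elt K) : exists x, P.[tofrac (val k)] = tofrac x.
  by apply: Pnum; exact: valP.
exists (\sum_(k <- msupp c) c@_k * l k).
have cX (j : 'I_(size P)) : \sum_(k <- msupp c) c@_k * val k ^+ j = (i == j)%:R.
  rewrite -coefXn -(cP 'X^j) ?size_polyXn //.
  by apply: eq_bigr => k _; rewrite hornerXn.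
rewrite rmorph_sum /=; under eq_bigr => k _.
  rewrite tofracM -lP horner_coef mulr_sumr.
  under eq_bigr => j _ do rewrite mulrCA -tofracXn -tofracM.
  over.
rewrite exchange_big /=.
under eq_bigr => j _ do rewrite -mulr_sumr -rmorph_sum /= cX.
have [lt_iP|le_Pi] := ltnP i (size P).
  rewrite (bigD1 (Ordinal lt_iP)) //= eqxx rmorph1 mulr1 big1 ?addr0 // => j.
  by rewrite -val_eqE /= eq_sym => /negPf ->; rewrite rmorph0 mulr0.
rewrite nth_default // big1 // => j _.
by rewrite gtn_eqF ?rmorph0 ?mulr0 // (leq_trans (ltn_ord j)).
Qed.

Lemma residues_eq (a x y : L) :
  (x - y \in principal_ideal a) =
  (\pi_(Quotient.quot (principal_ideal a)) x ==
   \pi_(Quotient.quot (principal_ideal a)) y)%qT.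
Proof. exact: Quotient.idealrBE. Qed.

Lemma infinite_residues {a : L} : infinite_set (residues a) ->
  exists q : nat -> L, (forall i, q i \in K) /\
    (forall i j, i != j -> q i - q j \notin principal_ideal a).
Proof.
pose Q := Quotient.quot (principal_ideal a).
(* [pcard_leP] needs a pointed codomain *)
pose pQ : pointedType := HB.pack Q (isPointed.Build Q 0).
move=> /infiniteP/(@pcard_leP _ pQ)/injfunPex[/= f fR f_inj].
have /choice[q qP] i :
    exists k, k \in K /\ (\pi_(Quotient.quot (principal_ideal a)) k)%qT = f i.
  by have [k kK <-] := fR i I; exists k.
exists q; split=> [i|i j]; first by have [] := qP i.
rewrite residues_eq (proj2 (qP i)) (proj2 (qP j)).
by apply: contraNN => /eqP /f_inj ->; rewrite ?inE.
Qed.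

Lemma finite_residues (a : L) : ~ infinite_set (residues a) ->
  exists s : seq L, forall k, k \in K ->
    exists2 k0, k0 \in s & k - k0 \in principal_ideal a.
Proof.
move=> /contrapT/finite_seqP[s sP].
exists (map (fun x : Quotient.quot (principal_ideal a) => repr x) s) => k kK.
exists (repr (\pi_(Quotient.quot (principal_ideal a)) k)%qT).
  apply: map_f.
  have : residues a (\pi_(Quotient.quot (principal_ideal a)) k)%qT by exists k.
  by rewrite sP.
by rewrite residues_eq reprK.
Qed.

(** Were s a finite list of representatives of K modulo a, the product of the
    X - k0 for k0 in s would take values divisible by a on K; its quotient by a
    is numerical, but its leading coefficient 1/a is not in L unless a is a
    unit. *)
Lemma no_numerical_infinite_residues : infinite_set [set` K] ->
  numerical_integral ->
  forall a, a \isn't a GRing.unit -> infinite_set (residues a).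
Proof.
move=> Kinf noNum a a_nunit; apply: contrapT => /finite_residues[s sP].
have [a0|a_neq0] := eqVneq a 0.
  (* congruence modulo 0 is equality, so K itself would be finite *)
  apply: Kinf; apply: sub_finite_set (finite_seq s) => k /= /sP[k0 k0s].
  move=> /principal_idealP[c]; rewrite a0 mulr0 => /eqP.
  by rewrite subr_eq0 => /eqP ->.
pose p : {poly L} := \prod_(k0 <- s) ('X - k0%:P).
have Fa_neq0 : tofrac a != 0 by rewrite tofrac_eq0.
have [r rE] : exists r,
    (tofrac a)^-1 *: map_poly (@tofrac L) p = map_poly (@tofrac L) r.
  apply: noNum; apply/asboolP => k kK.
  have [k0 k0s /principal_idealP[c kk0]] := sP k kK.
  have [d pk] : exists d, p.[k] = a * d.
    rewrite /p (perm_big _ (perm_to_rem k0s)) big_cons hornerM !hornerE kk0.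
    by rewrite (mulrC c) -mulrA; eexists.
  by exists d; rewrite hornerZ horner_map /= pk tofracM mulKf.
have arp : a *: r = p.
  apply: fraction_poly_inj; rewrite /= map_polyZ /= -rE.
  by rewrite scalerA mulfV // scale1r.
have := monic_prod_XsubC s xpredT id; rewrite -/p -arp.
move=> /eqP; rewrite lead_coefZ => ar1.
by case/negP: a_nunit; apply/unitrPr; exists (lead_coef r).
Qed.

End Residues.
Arguments residues {L} K a.
Arguments numerical_integral {L} K.

(** * Factorial rings *)

Section Divisibility.
Context {L : idomainType}.

Definition prime_elt (p : L) : Prop :=
  p \isn't a GRing.unit /\
  forall x y, x * y \in principal_ideal p ->
    x \in principal_ideal p \/ y \in principal_ideal p.

Lemma principal_idealMl (a x y : L) :
  y \in principal_ideal a -> x * y \in principal_ideal a.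
Proof.
by case/principal_idealP=> c ->; apply/principal_idealP; exists (x * c);
  rewrite mulrA.
Qed.

Lemma prime_prodN {p : L} {I : Type} {r : seq I} {A : pred I} {F : I -> L} :
  prime_elt p -> (forall i, A i -> F i \notin principal_ideal p) ->
  \prod_(i <- r | A i) F i \notin principal_ideal p.
Proof.
move=> [p_nunit p_prime] FA; elim/big_ind: _ => // [|x y xp yp].
  apply: contra p_nunit => /principal_idealP[c /esym c1].
  by apply/unitrPr; exists c; rewrite mulrC.
by apply/negP => /p_prime[]; apply/negP.
Qed.

Lemma UFD_factor {x : L} : is_UFD L -> x != 0 ->
  exists2 s : seq L, (forall y, y \in s -> irreducible_elt y) &
    associates (\prod_(y <- s) y) x.
Proof.
move=> [ex _] x0; have [ux|nux] := boolP (x \is a GRing.unit).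
  by exists [::] => //; apply/asboolP; exists x; rewrite // big_nil mulr1.
have [s s_irr ->] := ex _ x0 nux; exists s => //.
by apply/asboolP; exists 1; rewrite ?unitr1 ?mul1r.
Qed.

(** If x * y = z * p, then p occurs up to a unit among the irreducible factors
    of x and y, by uniqueness of the factorisation. *)
Lemma UFD_prime {p : L} : is_UFD L -> irreducible_elt p -> prime_elt p.
Proof.
move=> ufd p_irr; split=> [|x y]; first by case: p_irr.
have [->|x0] := eqVneq x 0; first by left; apply: rpred0.
have [->|y0] := eqVneq y 0; first by right; apply: rpred0.
move=> /principal_idealP[z xyz].
have z0 : z != 0.
  by apply: contra_eq_neq xyz => ->; rewrite mul0r mulf_neq0.
have [s s_irr /asboolP[u uu xE]] := UFD_factor ufd x0.
have [t t_irr /asboolP[v uv yE]] := UFD_factor ufd y0.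
have [r r_irr /asboolP[w uw zE]] := UFD_factor ufd z0.
have st_irr d : d \in s ++ t -> irreducible_elt d.
  by rewrite mem_cat => /orP[/s_irr|/t_irr].
have pr_irr d : d \in p :: r -> irreducible_elt d.
  by rewrite inE => /orP[/eqP ->|/r_irr].
have [|t' tt' pt'] := (proj2 ufd) (p :: r) (s ++ t) pr_irr st_irr.
  apply/asboolP; exists (u^-1 * v^-1 * w).
    by rewrite !unitrM !unitrV uu uv.
  rewrite big_cons big_cat /=.
  have -> : u^-1 * v^-1 * w * (p * \prod_(y <- r) y) =
            u^-1 * v^-1 * (z * p) by rewrite zE (mulrC p) -!mulrA.
  rewrite -xyz xE yE (mulrACA u) [RHS]mulrA (mulrACA u^-1).
  by rewrite !mulVr // !mul1r.
case: t' tt' pt' => [|d t'] // tt' /= /andP[/asboolP[e ue dE] _].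
(* d is the factor of x * y associated with p *)
have d_st : d \in s ++ t by rewrite (perm_mem tt') mem_head.
have divides (l : seq L) g z' : d \in l -> z' = g * \prod_(b <- l) b ->
    z' \in principal_ideal p.
  move=> dl ->; rewrite (perm_big _ (perm_to_rem dl)) big_cons /=.
  apply/principal_idealP; exists (g * (e * \prod_(b <- rem d l) b)).
  by rewrite {1}dE -!mulrA (mulrC p).
by move: d_st; rewrite mem_cat => /orP[ds|dt]; [left|right]; apply: divides;
  [exact: ds|exact: xE|exact: dt|exact: yE].
Qed.

End Divisibility.

Section NumericalUFD.
Context {L : idomainType} {K : subringClosed L}.

(** For nodes in K that are pairwise incongruent modulo p, the Vandermonde
    determinant is not divisible by p, whereas its product with any coefficient
    of Q is a combination of values of Q and thus divisible by p. *)
Lemma prime_divides_coefs (p : L) (Q : {poly L}) :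
  prime_elt p -> infinite_set (residues K p) ->
  (forall k, k \in K -> Q.[k] \in principal_ideal p) ->
  forall i, Q`_i \in principal_ideal p.
Proof.
move=> p_prime /infinite_residues[q [qK q_sep]] Qp i.
have [w /(_ Q (leqnn _)) wQ] := adjugate_interpolation q (size Q) i.
have : \sum_(m < size Q) w m * Q.[q m] \in principal_ideal p.
  by apply: rpred_sum => m _; apply: principal_idealMl; apply: Qp.
rewrite wQ => /(proj2 p_prime)[|//].
apply: contraLR => _; apply: (prime_prodN p_prime) => j _.
by apply: (prime_prodN p_prime) => m lt_jm; apply: q_sep; rewrite gtn_eqF.
Qed.

(** If b * P = Q is integral and p is a prime factor of b, then p divides the
    values of Q on K, hence its coefficients, and can be cancelled on both
    sides; induction on the factorisation of b removes the denominator. *)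
Lemma UFD_numerical : is_UFD L ->
  (forall a, a \isn't a GRing.unit -> infinite_set (residues K a)) ->
  numerical_integral K.
Proof.
move=> ufd res P Pnum; have [Q [b [b0 PQ]]] := poly_denominator P.
have [s s_irr /asboolP[u uu bE]] := UFD_factor ufd b0.
have {b0 PQ bE} :
    tofrac (\prod_(y <- s) y) *: P = map_poly (@tofrac L) (u^-1 *: Q).
  by rewrite map_polyZ /= -PQ bE scalerA -tofracM mulKr.
elim: s s_irr (u^-1 *: Q) => [_ {}Q|p s IHs ps_irr {}Q].
  by rewrite big_nil rmorph1 scale1r; exists Q.
rewrite big_cons tofracM -scalerA => PQ.
have p_irr := ps_irr p (mem_head _ _).
have p_prime := UFD_prime ufd p_irr.
have Fp0 : tofrac p != 0 by rewrite tofrac_eq0; case: p_irr.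
have Qp k : k \in K -> Q.[k] \in principal_ideal p.
  move=> kK; have /asboolP/(_ k kK)[l lP] := Pnum.
  apply/principal_idealP; exists (\prod_(y <- s) y * l); apply/eqP.
  rewrite -tofrac_eq -horner_map /= -PQ !hornerZ lP !tofracM.
  by rewrite mulrC.
have /choice[a aP] i : exists x, Q`_i = x * p.
  by apply/principal_idealP; apply: prime_divides_coefs => //;
    apply: res; case: p_prime.
apply: (IHs _ (\poly_(i < size Q) a i)) => [y ys|].
  by apply: ps_irr; rewrite inE ys orbT.
apply: (scalerI Fp0); rewrite PQ -map_polyZ; congr map_poly.
apply/polyP => i; rewrite coefZ coef_poly mulrC.
by case: ltnP => [_|/(nth_default 0) ->]; rewrite ?mul0r ?aP.
Qed.

End NumericalUFD.

(** * Discrete valuation rings *)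

(** A nonzero element of L that is not a multiple of the uniformizer a has
    valuation 0, so its inverse belongs to L as well. *)
Lemma DVR_DS {L : idomainType} {K : subringClosed L} : is_DVR L ->
  (forall a, a \isn't a GRing.unit -> infinite_set (residues K a)) ->
  DS_extension K.
Proof.
move=> [v [vM _ v_onto v_ge0]] res.
have F0 (x : L) : x != 0 -> tofrac x != 0 by rewrite tofrac_eq0.
have v1 : v 1 = 0.
  by apply: (addrI (v 1)); rewrite addr0 -vM ?oner_neq0 // mulr1.
have vV f : f != 0 -> v f^-1 = - v f.
  by move=> f0; apply/eqP; rewrite -addr_eq0 addrC -vM ?invr_eq0 // mulfV // v1.
have v_int (x : L) : x != 0 -> (0 <= v (tofrac x))%R.
  by move=> /F0 x0; apply/v_ge0 => //; exists x.
have [f f0 vf] := v_onto 1.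
have [a fa] : exists a, f = tofrac a by apply/v_ge0; rewrite ?vf.
have a_nunit : a \isn't a GRing.unit.
  apply/negP => /unitrPr[b ab].
  have b0 : b != 0.
    by apply: contra_eq_neq ab => ->; rewrite mulr0 eq_sym oner_eq0.
  have := v_int b b0; have: v (tofrac a) + v (tofrac b) = 0.
    by rewrite -fa -vM ?F0 // fa -tofracM ab rmorph1.
  by rewrite -fa vf => /eqP; rewrite addrC addr_eq0 => /eqP ->.
have [q [qK q_sep]] := infinite_residues (res _ a_nunit).
exists q; split=> // i j /q_sep; move: (q i - q j) => d d_ndiv.
have d0 : d != 0 by apply: contraNneq d_ndiv => ->; apply: rpred0.
have vd : v (tofrac d) = 0.
  apply/eqP; apply: contraNT d_ndiv => vd_neq0.
  have df0 : tofrac d / f != 0 by rewrite mulf_neq0 ?invr_eq0 ?F0.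
  have [|c dc] := proj1 (v_ge0 _ df0).
    rewrite vM ?invr_eq0 ?F0 // vV // vf.
    by case: (v _) (v_int d d0) vd_neq0 => [[|m]|m].
  apply/principal_idealP; exists c; apply/eqP.
  by rewrite -tofrac_eq tofracM -dc -fa divfK.
have dV0 : (tofrac d)^-1 != 0 by rewrite invr_eq0 F0.
have [|e de] := proj1 (v_ge0 _ dV0).
  by rewrite vV ?F0 // vd oppr0.
apply/unitrPr; exists e; apply/eqP.
by rewrite -tofrac_eq tofracM -de mulfV ?F0 ?rmorph1.
Qed.

(** * The implications *)

Theorem theorem4p4 (L : idomainType) (K : subringClosed L)
    (Kinf : infinite_set [set` K]) :
  let cond1 := DS_extension K in
  let cond2 := asymptotically_split (@ev L K) in
  let cond2' := dense (range (@dual_ev L K)) in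
  let cond3 := [set` NumPoly K] = range (map_poly (@tofrac L)) in
  let cond4 := forall a : L, a \isn't a GRing.unit ->
    infinite_set [set (\pi_(Quotient.quot (principal_ideal a)) k)%qT | k in [set` K]] in
  (cond2 <-> cond2') /\
  (cond1 -> cond2) /\ (cond2 -> cond3) /\ (cond3 -> cond4) /\
  (is_UFD L -> cond4 -> cond3) /\
  (is_DVR L -> cond4 -> cond1).
Proof.
move=> cond1 cond2 cond2' cond3 cond4.
have cond3E : cond3 <-> numerical_integral K.
  rewrite /cond3; split=> [NumE P PNum|intK].
    have : [set` NumPoly K] P by [].
    by rewrite NumE => -[p _ <-]; exists p.
  apply/seteqP; split=> [P /intK[p ->]|_ [p _ <-]]; first by exists p.
  exact: integral_is_numerical.
split; first split.
- by move/split_extracts/extracts_dense.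
- by move/dense_extracts/extracts_split.
split; first by move/DS_extracts/extracts_split.
split; first by move=> /split_extracts/extracts_numerical/cond3E.
split; first by move=> /cond3E; exact: no_numerical_infinite_residues.
split; first by move=> ufd res; apply/cond3E; exact: UFD_numerical.
exact: DVR_DS.
Qed.
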